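(* The rank of the path Jacobian matrix $J(w)$ is generically (i.e. for all $w\in\mathbb R^{E}$ outside a set of zero Lebesgue measure) equal to the number of parameters $|E|$ minus the number of internal nodes of the network.
   Context: $G=(V,E)$ is a finite directed acyclic graph of a feedforward network, with input nodes $V_{\rm in}$ (no incoming edges), output nodes $V_{\rm out}$ (no outgoing edges), and remaining nodes called internal; every internal node and every edge lies on some directed path from an input node to an output node. Each edge $e$ carries its own real weight $w_e$ (no weight sharing). $\Pi$ is the set of all directed paths from an input node to an output node; for $p\in\Pi$, $\pi_p(w)=\prod_{e\in p}w_e$. The path Jacobian is $J(w)=(\partial\pi_p(w)/\partial w_e)_{p\in\Pi,\,e\in E}\in\mathbb R^{|\Pi|\times|E|}$. *)

(* Defs.v *)
From HB Require Import structures.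
From mathcomp Require Import all_boot all_order all_algebra.
From mathcomp Require Import all_classical all_reals all_analysis.

Set Implicit Arguments.
Unset Strict Implicit.
Unset Printing Implicit Defensive.

Import Order.TTheory GRing.Theory Num.Theory.
Import numFieldNormedType.Exports.

Local Open Scope ring_scope.

Section lebesgue_cons.
Local Open Scope classical_set_scope.
Context (R : realType) (n : nat).
Local Notation T := (measurableTypeR R).
Variable mu : {sigma_finite_measure set (n.-tuple T) -> \bar R}.

Definition tuple_cons (x : T * n.-tuple T) : n.+1.-tuple T :=
  [the n.+1.-tuple T of x.1 :: x.2].

Lemma measurable_tuple_cons : measurable_fun [set: T * n.-tuple T] tuple_cons.
Proof. exact: measurable_cons. Qed.

Definition lebesgue_cons : set (n.+1.-tuple T) -> \bar R :=
  pushforward (@lebesgue_measure R \x mu)%E tuple_cons.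

Let measurable_preimage A : measurable A -> measurable (tuple_cons @^-1` A).
Proof.
by move=> mA; rewrite -[X in measurable X]setTI; exact: measurable_tuple_cons.
Qed.

Let lebesgue_cons0 : lebesgue_cons set0 = 0%E.
Proof. by rewrite /lebesgue_cons /pushforward preimage_set0 measure0. Qed.

Let lebesgue_cons_ge0 A : (0 <= lebesgue_cons A)%E.
Proof. by rewrite /lebesgue_cons /pushforward; exact: measure_ge0. Qed.

Let lebesgue_cons_sigma_additive : semi_sigma_additive lebesgue_cons.
Proof.
move=> F mF tF mUF; rewrite /lebesgue_cons /pushforward preimage_bigcup.
apply: measure_semi_sigma_additive.
- by move=> i; exact: measurable_preimage.
- apply/trivIsetP => /= i j _ _ ij; rewrite -preimage_setI.
  by move/trivIsetP : tF => /(_ _ _ _ _ ij) ->//; rewrite preimage_set0.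
- by rewrite -preimage_bigcup; exact: measurable_preimage.
Qed.

HB.instance Definition _ := isMeasure.Build _ _ _ lebesgue_cons
  lebesgue_cons0 lebesgue_cons_ge0 lebesgue_cons_sigma_additive.

Let uncons (t : n.+1.-tuple T) : T * n.-tuple T :=
  (thead t, [tuple of behead t]).

Let unconsK : cancel uncons tuple_cons.
Proof. by move=> t; rewrite [RHS]tuple_eta; exact: val_inj. Qed.

Let consK : cancel tuple_cons uncons.
Proof.
by case=> x t; rewrite /uncons /tuple_cons /=; congr (_, _); exact: val_inj.
Qed.

Let measurable_uncons : measurable_fun [set: n.+1.-tuple T] uncons.
Proof.
apply: measurable_fun_pair; last exact: measurable_behead.
exact: measurable_tnth.
Qed.

Let lebesgue_cons_sigma_finite : sigma_finite setT lebesgue_cons.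
Proof.
have /sigma_finiteP[F [TF ndF Foo]] := sigma_finiteT (@lebesgue_measure R).
have /sigma_finiteP[G [TG ndG Goo]] := sigma_finiteT mu.
exists (fun k => uncons @^-1` (F k `*` G k)).
  rewrite -preimage_bigcup; apply/esym/seteqP; split=> // t _.
  have [i _ Fi] : (\bigcup_i F i) (uncons t).1 by rewrite -TF.
  have [j _ Gj] : (\bigcup_j G j) (uncons t).2 by rewrite -TG.
  exists (maxn i j) => //; split.
  - by move: Fi; exact/subsetPset/ndF/leq_maxl.
  - by move: Gj; exact/subsetPset/ndG/leq_maxr.
move=> k; have [mF Fk] := Foo k; have [mG Gk] := Goo k; split.
  rewrite -[X in measurable X]setTI; apply: measurable_uncons => //.
  exact: measurableX.
rewrite /lebesgue_cons /pushforward (_ : _ @^-1` _ = F k `*` G k).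
  by rewrite product_measure1E// lte_mul_pinfty// ge0_fin_numE.
by apply/funext => x; rewrite -[RHS]/((F k `*` G k) x) -{2}(consK x).
Qed.

HB.instance Definition _ := @Measure_isSigmaFinite.Build _ _ _ lebesgue_cons
  lebesgue_cons_sigma_finite.

End lebesgue_cons.

(** The library's measurable structure on R^n is on tuples, not on ['rV[R]_n]. *)
Fixpoint lebesgue_tuple (R : realType) (n : nat) :
    {sigma_finite_measure set (n.-tuple (measurableTypeR R)) -> \bar R} :=
  match n with
  | 0 => \d_([tuple] : 0.-tuple (measurableTypeR R))
  | m.+1 => lebesgue_cons (lebesgue_tuple R m)
  end.

Section lebesgue_tuple_box.
Local Open Scope classical_set_scope.

Lemma lebesgue_tuple_box (R : realType) (n : nat)
    (A : 'I_n -> set (measurableTypeR R)) :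
  (forall i, measurable (A i)) ->
  lebesgue_tuple R n [set t | forall i, A i (tnth t i)] =
  (\prod_(i < n) lebesgue_measure (A i))%E.
Proof.
elim: n A => [|n IHn] A mA.
  by rewrite big_ord0 /= diracE mem_set// => -[].
rewrite big_ord_recl -IHn; last by move=> i; exact: mA.
rewrite /= /lebesgue_cons /pushforward.
rewrite (_ : _ @^-1` _ = A ord0 `*`
    [set t : n.-tuple _ | forall i, A (lift ord0 i) (tnth t i)]).
  rewrite product_measure1E//.
  rewrite (_ : [set _ | _] = \bigcap_(i in [set: 'I_n])
      ((@tnth _ _)^~ i @^-1` A (lift ord0 i))).
    apply: fin_bigcap_measurable => // i _.
    by rewrite -[X in measurable X]setTI; exact: measurable_tnth.
  by apply/seteqP; split=> t /= At i => [_|]; exact: At.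
apply/seteqP; split=> -[x t] /=.
  move=> At; split=> [|i]; first exact: (At ord0).
  by have := At (lift ord0 i); rewrite tnthS.
move=> [Ax At] i; case: (unliftP ord0 i) => [j|] -> //.
by rewrite tnthS; exact: At.
Qed.

End lebesgue_tuple_box.

Definition generically (R : realType) (n : nat) (P : 'rV[R]_n -> Prop) : Prop :=
  {ae lebesgue_tuple R n, forall t, P (\row_i tnth t i)}.

Section network.
Variables (V : finType) (E : {set V * V}) (Vin Vout : {set V}).

Definition edge_rel : rel V := fun u v => (u, v) \in E.

(** A directed path is the sequence of its vertices. *)
Definition path_edges (s : seq V) : seq (V * V) := zip s (behead s).

Definition io_path (s : seq V) : bool :=
  if s is x :: p then
    [&& x \in Vin, path edge_rel x p & last x p \in Vout]
  else false.

Definition internal : {set V} := ~: (Vin :|: Vout).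

Record feedforward : Prop := Feedforward {
  ff_acyclic : forall c : seq V, cycle edge_rel c -> c = [::];
  ff_input : forall u v, v \in Vin -> (u, v) \notin E;
  ff_output : forall u v, u \in Vout -> (u, v) \notin E;
  ff_internal : forall v, v \in internal -> exists2 s, io_path s & v \in s;
  ff_edge : forall e, e \in E -> exists2 s, io_path s & e \in path_edges s
}.

Definition io_paths : {set {bseq #|V| of V}} :=
  [set s : {bseq #|V| of V} | io_path s].

(** By acyclicity the length bound in [io_paths] excludes no path. *)
Lemma io_path_size s : feedforward -> io_path s -> (size s <= #|V|)%N.
Proof.
case=> acyc _ _ _ _; case: s => // x p /and3P[_ xp _].
suff /card_uniqP <- : uniq (x :: p) by exact: max_card.
elim: p x xp => // y p IHp x xyp; have /= /andP[_ yp] := xyp.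
have /= -> := IHp _ yp; rewrite andbT; move: xyp.
apply: contraTN => xin; case/splitPr: xin => p1 p2.
rewrite cat_path /=; apply/negP => /and3P[xp1 p1x _].
by have := acyc (x :: p1); rewrite /= rcons_path xp1 p1x => /(_ isT).
Qed.

End network.

Section path_jacobian.
Variables (R : realType) (V : finType) (E : {set V * V}) (Vin Vout : {set V}).

(** The edges are numbered by [enum_val : 'I_#|E| -> V * V], so that R^E is
    ['rV[R]_#|E|].  In an acyclic graph no edge occurs twice in a path, so the
    product over the edges occurring in [s] is the product along [s]. *)
Definition path_monomial (s : seq V) (w : 'rV[R]_#|E|) : R :=
  \prod_(i < #|E| | enum_val i \in path_edges s) w 0 i.

Definition path_jacobian (w : 'rV[R]_#|E|) :
    'M[R]_(#|io_paths E Vin Vout|, #|E|) :=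
  \matrix_(p < #|io_paths E Vin Vout|, i < #|E|)
    'D_(delta_mx 0 i) (path_monomial (enum_val p)) w.

End path_jacobian.

(* Main.v *)
(** Where all weights are nonzero, which is almost everywhere, [J(w)] is
    [diag(pi_p(w)) * P * diag(1/w_e)], with [P] the path-edge incidence matrix,
    so [J(w)] and [P] have the same rank.  An edge labelling is killed by [P]
    when it sums to zero along every input-output path.  These labellings are
    exactly the coboundaries [phi(v) - phi(u)] on edges [(u, v)] of potentials
    [phi] vanishing on inputs and outputs.  As every internal node is joined to
    an input, such a [phi] is determined by its coboundary, so [ker P] has
    dimension the number of internal nodes. *)

Require Import Defs.
From mathcomp Require Import all_boot all_order all_algebra.
From mathcomp Require Import all_classical all_reals all_analysis.

Set Implicit Arguments.
Unset Strict Implicit.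
Unset Printing Implicit Defensive.

Import Order.TTheory GRing.Theory Num.Theory.
Import numFieldNormedType.Exports.

Local Open Scope ring_scope.

(** * Nonvanishing of generic weights; partial derivatives of monomials *)

Section generic_point.
Local Open Scope classical_set_scope.

(** The exceptional set is a finite union of coordinate hyperplanes, each a null box with one side
    [[set 0]]. *)
Lemma generically_neq0 (R : realType) (n : nat) :
  generically (fun w : 'rV[R]_n => forall i, w 0 i != 0).
Proof.
pose A (i j : 'I_n) : set (measurableTypeR R) := if j == i then [set 0] else setT.
have mA i j : measurable (A i j) by rewrite /A; case: ifP.
pose H i := [set t : n.-tuple (measurableTypeR R) | forall j, A i j (tnth t j)].
have H0 i : lebesgue_tuple R n (H i) = 0%E.
  rewrite lebesgue_tuple_box// (bigD1 i)//= /A eqxx.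
  (* The other sides have infinite length; the convention that zero times infinity is zero
     applies. *)
  by rewrite (_ : lebesgue_measure _ = 0%E) ?mul0e// lebesgue_measure_set1.
have mH i : measurable (H i).
  rewrite (_ : H i = \bigcap_(j in [set: 'I_n]) ((@tnth _ _)^~ j @^-1` A i j)).
    apply: fin_bigcap_measurable => // j _.
    by rewrite -[X in measurable X]setTI; exact: measurable_tnth.
  by apply/seteqP; split=> t /= Ht j => [_|]; exact: Ht.
have : (lebesgue_tuple R n).-negligible (\big[setU/set0]_(i < n) H i).
  apply: (@big_ind _ (lebesgue_tuple R n).-negligible) => [|X Y|i _].
  - exact: negligible_set0.
  - exact: negligibleU.
  - by exists (H i); split.
apply: negligibleS => t /= /existsNP[i] /negP; rewrite negbK mxE => /eqP ti0.
by rewrite (bigD1 i)//=; left=> j; rewrite /A; case: eqP => [->|].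
Qed.

(** The product is affine in coordinate [i], so the difference quotient does not depend on
    [h != 0]. *)
Lemma derive_prod_coord (R : realType) (n : nat) (P : pred 'I_n) (i : 'I_n)
    (w : 'rV[R]_n) :
  'D_(delta_mx 0 i) (fun v : 'rV[R]_n => \prod_(j | P j) v 0 j) w =
  if P i then \prod_(j | P j && (j != i)) w 0 j else 0.
Proof.
rewrite /derive; apply: cvg_lim => //.
apply: (@cvg_trans _ ((fun=> if P i then \prod_(j | P j && (j != i)) w 0 j else 0)
  @ (0 : R)^')); last exact: cvg_cst.
apply: near_eq_cvg; near=> h.
have h0 : h != 0 by near: h; exact: nbhs_dnbhs_neq.
have off j : j != i -> (h *: delta_mx 0 i + w) 0 j = w 0 j.
  by move=> ji; rewrite !mxE/= (negbTE ji) mulr0 add0r.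
case: ifP => Pi.
  rewrite /= !(bigD1 i Pi)/=.
  have -> : \prod_(j | P j && (j != i)) (h *: delta_mx 0 i + w) 0 j =
      \prod_(j | P j && (j != i)) w 0 j by apply: eq_bigr => j /andP[_ /off].
  rewrite -mulrBl !mxE !eqxx mulr1 addrK /GRing.scale/=.
  by rewrite mulrA mulVf// mul1r.
rewrite /= [X in _ *: (X - _)](eq_bigr (fun j => w 0 j)).
  by rewrite subrr scaler0.
by move=> j Pj; apply: off; apply: contraFneq Pi => <-.
Unshelve. all: by end_near. Qed.

End generic_point.

(** * Edge lists of paths: concatenation, splitting, telescoping *)

Section path_edges.
Variable V : finType.
Implicit Types (x : V) (p q : seq V).

Lemma path_edges_cat x p q :
  path_edges (x :: p ++ q) = path_edges (x :: p) ++ path_edges (last x p :: q).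
Proof. by elim: p x => //= y p IHp x; rewrite /path_edges/= -IHp. Qed.

Lemma path_edges_split x p e : e \in path_edges (x :: p) ->
  exists p1 p2, p = p1 ++ e.2 :: p2 /\ last x p1 = e.1.
Proof.
elim: p x => //= y p IHp x; rewrite inE => /predU1P[-> /=|/IHp[p1 [p2 [-> <-]]]].
  by exists [::], p.
by exists (y :: p1), p2.
Qed.

Lemma sum_path_edges_diff (M : zmodType) (phi : V -> M) x p :
  \sum_(e <- path_edges (x :: p)) (phi e.2 - phi e.1) = phi (last x p) - phi x.
Proof.
elim: p x => [|y p IHp] x; first by rewrite big_nil subrr.
by rewrite /path_edges/= big_cons [X in _ + X]IHp/= addrC subrKA.
Qed.

Lemma sub_path_edges (E : {set V * V}) x p :
  path (edge_rel E) x p -> {subset path_edges (x :: p) <= E}.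
Proof.
elim: p x => //= y p IHp x /andP[xy /IHp yp] e.
by rewrite inE => /predU1P[->|/yp].
Qed.

End path_edges.

(** * Kernel and rank of the path-edge incidence matrix over a field *)

Section incidence.
Variables (F : fieldType) (V : finType) (E : {set V * V}) (Vin Vout : {set V}).
Hypothesis netE : feedforward E Vin Vout.

Local Notation internal := (internal Vin Vout).
Local Notation io_path := (io_path E Vin Vout).
Local Notation io_paths := (io_paths E Vin Vout).

Lemma path_edge_rel_uniq x p : path (edge_rel E) x p -> uniq (x :: p).
Proof.
elim: p x => // y p IHp x xyp; have /= /andP[_ yp] := xyp.
have /= -> := IHp _ yp; rewrite andbT; move: xyp.
apply: contraTN => xin; case/splitPr: xin => p1 p2.
rewrite cat_path /=; apply/negP => /and3P[xp1 p1x _].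
have := ff_acyclic netE (c := x :: p1); rewrite /= rcons_path xp1 p1x.
by move/(_ isT).
Qed.

(** By acyclicity the vertices of a path, hence its edges, are distinct. *)
Lemma sum_io_path (M : nmodType) s (g : V * V -> M) : io_path s ->
  \sum_(i < #|E| | enum_val i \in path_edges s) g (enum_val i) =
  \sum_(e <- path_edges s) g e.
Proof.
case: s => // x p /and3P[_ xp _].
rewrite [RHS]big_uniq/=; last exact/zip_uniql/path_edge_rel_uniq.
rewrite -(big_enum_val_cond (fun e => e \in path_edges (x :: p))) /=.
by apply: eq_bigl => e; rewrite andb_idl// => /(sub_path_edges xp).
Qed.

Lemma io_path_enum_val s :
  io_path s -> exists p : 'I_#|io_paths|, enum_val p = s :> seq V.
Proof.
move=> s_io; have ss := io_path_size netE s_io.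
have sP : Bseq ss \in io_paths by rewrite inE.
by exists (enum_rank_in sP (Bseq ss)); rewrite enum_rankK_in.
Qed.

Lemma enum_val_io_path (p : 'I_#|io_paths|) : io_path (enum_val p).
Proof. by have := enum_valP p; rewrite inE. Qed.

Definition path_incidence : 'M[F]_(#|io_paths|, #|E|) :=
  \matrix_(p < #|io_paths|, i < #|E|) (enum_val i \in path_edges (enum_val p))%:R.

(** The signed vertex-edge incidence matrix, restricted to internal vertices. *)
Definition coboundary : 'M[F]_(#|internal|, #|E|) :=
  \matrix_(k < #|internal|, i < #|E|) (((enum_val i).2 == enum_val k)%:R -
                  ((enum_val i).1 == enum_val k)%:R).

(** Extension of [a] by zero to the inputs and outputs. *)
Definition potential (a : 'rV[F]_#|internal|) (v : V) : F :=
  \sum_k a 0 k * (v == enum_val k)%:R.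

Lemma potential_enum_val a k : potential a (enum_val k) = a 0 k.
Proof.
rewrite /potential (bigD1 k)//= eqxx mulr1 big1 ?addr0// => j jk.
by rewrite (inj_eq enum_val_inj) eq_sym (negbTE jk) mulr0.
Qed.

Lemma potential_boundary a v : v \notin internal -> potential a v = 0.
Proof.
move=> vN; rewrite /potential big1// => k _.
by case: eqP vN => [->|]; rewrite ?enum_valP// mulr0.
Qed.

Lemma mul_coboundaryE a i :
  (a *m coboundary) 0 i =
  potential a (enum_val i).2 - potential a (enum_val i).1.
Proof.
rewrite mxE -sumrB; apply: eq_bigr => k _.
by rewrite mxE mulrBr.
Qed.

(** [kermx] is a left kernel, so edge labellings are row vectors multiplying the transpose. *)
Lemma mul_path_incidenceE (g : V * V -> F) p :
  ((\row_i g (enum_val i)) *m path_incidence^T) 0 p =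
  \sum_(e <- path_edges (enum_val p)) g e.
Proof.
rewrite -sum_io_path ?enum_val_io_path// mxE [RHS]big_mkcond.
by apply: eq_bigr => i _; rewrite !mxE; case: ifP; rewrite ?mulr1 ?mulr0.
Qed.

(** A potential with zero coboundary is constant along paths; it vanishes at inputs, and every
    internal vertex is reached from one. *)
Lemma coboundary_free : row_free coboundary.
Proof.
apply: inj_row_free => a aB0; apply/rowP => k; rewrite [RHS]mxE.
have [[|x p]] // := ff_internal netE (enum_valP k).
move=> /and3P[xin xp _] kp.
have [p1 [p2 [pE lastk]]] :
    exists p1 p2, p = p1 ++ p2 /\ last x p1 = enum_val k.
  by case/splitPl: kp => p1 p2; exists p1, p2.
have xp1 : path (edge_rel E) x p1 by move: xp; rewrite pE cat_path => /andP[].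
rewrite -potential_enum_val -lastk -[LHS]subr0.
rewrite -[X in _ - X](@potential_boundary a x); last by rewrite !inE xin.
rewrite -sum_path_edges_diff big_seq big1// => e /(sub_path_edges xp1) eE.
by rewrite -(enum_rankK_in eE eE) -mul_coboundaryE aB0 mxE.
Qed.

(** Each row is the coboundary of the indicator of an internal vertex; its sum along an input-output
    path telescopes to the end values, both zero. *)
Lemma coboundary_sub_ker : (coboundary <= kermx path_incidence^T)%MS.
Proof.
apply/row_subP => k; apply/sub_kermxP/rowP => p; rewrite [RHS]mxE.
pose at_k (v : V) : F := (v == enum_val k)%:R.
have -> : row k coboundary =
    \row_i (fun e => at_k e.2 - at_k e.1) (enum_val i).
  by apply/rowP => i; rewrite !mxE.
rewrite (mul_path_incidenceE (fun e => at_k e.2 - at_k e.1)).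
have := enum_val_io_path p.
case: (bseqval _) => // x q /and3P[xin _ qout].
rewrite (sum_path_edges_diff at_k) /at_k.
have := enum_valP k; rewrite !inE negb_or => /andP[kin kout].
by rewrite (negbTE (memPn kout _ qout)) (negbTE (memPn kin _ xin)) subrr.
Qed.

(* The potential at [v] is minus the sum along some path from [v] to [Vout]; it
   equals the sum along every path from [Vin] to [v]. *)
Lemma ker_sub_coboundary : (kermx path_incidence^T <= coboundary)%MS.
Proof.
apply/rV_subP => a /sub_kermxP a0.
(* [enum_rank_in] needs some edge [e0]; without edges [a] is an empty row. *)
case: (pickP (mem E)) => [e0 e0E|E0]; last first.
  suff -> : a = 0 by exact: sub0mx.
  by apply/rowP => i; have := E0 (enum_val i); rewrite /= enum_valP.
pose g e := a 0 (enum_rank_in e0E e).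
have aE : a = \row_i g (enum_val i).
  by apply/rowP => i; rewrite mxE /g enum_valK_in.
have g0 s : io_path s -> \sum_(e <- path_edges s) g e = 0.
  move=> /io_path_enum_val[p <-].
  by rewrite -mul_path_incidenceE -aE a0 mxE.
have potentialP v : exists r : F, forall x p, x \in Vin ->
    path (edge_rel E) x p -> last x p = v ->
    (exists q, path (edge_rel E) v q && (last v q \in Vout)) ->
    \sum_(e <- path_edges (x :: p)) g e = r.
  case: (pselect (exists q, path (edge_rel E) v q && (last v q \in Vout))).
    move=> [q /andP[vq qout]]; exists (- \sum_(e <- path_edges (v :: q)) g e).
    move=> x p xin xp pv _; apply/eqP; rewrite -addr_eq0 -{1}pv -big_cat/=.
    rewrite -path_edges_cat g0//= xin cat_path xp pv vq/=.
    by rewrite last_cat pv.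
  (* With no path from [v] to [Vout] the claim is vacuous and the value arbitrary. *)
  by move=> nq; exists 0.
have [phi phiP] := choice potentialP.
apply/submxP; exists (\row_k phi (enum_val k)).
apply/rowP => i; rewrite mul_coboundaryE.
set e := enum_val i; have eE : e \in E by exact: enum_valP.
have [[|x p]] // := ff_edge netE eE; move=> s_io.
have /and3P[xin xp pout] := s_io.
move=> /path_edges_split[p1 [p2 [pE p1e]]].
have phiE x' p' v : x' \in Vin -> path (edge_rel E) x' p' -> last x' p' = v ->
    (exists q, path (edge_rel E) v q && (last v q \in Vout)) ->
    \sum_(e <- path_edges (x' :: p')) g e = phi v by exact: phiP.
have [xp1 e2p2] : path (edge_rel E) x p1 /\ path (edge_rel E) e.2 p2.
  by move: xp; rewrite pE cat_path /= => /and3P[].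
have e2out : last e.2 p2 \in Vout by rewrite pE last_cat in pout.
have phi1 : \sum_(e <- path_edges (x :: p1)) g e = phi e.1.
  apply: phiE => //; exists (e.2 :: p2) => /=.
  by rewrite e2p2 e2out /edge_rel -surjective_pairing eE.
have phi2 : \sum_(e <- path_edges (x :: rcons p1 e.2)) g e = phi e.2.
  apply: phiE; rewrite ?rcons_path ?last_rcons ?xp1 ?p1e//.
    by rewrite /edge_rel -surjective_pairing eE.
  by exists p2; rewrite e2p2.
(* Restricting [phi] to internal vertices loses nothing: it is zero at inputs by the empty path, and
   at outputs because complete paths sum to zero. *)
have phi_internal v : (exists q, path (edge_rel E) v q && (last v q \in Vout)) ->
    (exists x p, [&& x \in Vin, path (edge_rel E) x p & last x p == v]) ->
    potential (\row_k phi (enum_val k)) v = phi v.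
  move=> vout [x' [p' /and3P[x'in x'p' /eqP p'v]]].
  have [vint|vN] := boolP (v \in internal).
    by rewrite -(enum_rankK_in vint vint) potential_enum_val mxE.
  rewrite potential_boundary//; move: vN; rewrite !inE negbK => /orP[vin|vout'].
    by rewrite -(phiE v [::] v vin)// big_nil.
  by rewrite -(phiE _ _ _ x'in x'p' p'v)// g0//= x'in x'p' p'v.
rewrite !phi_internal.
(* The path to [e.2] is the path to [e.1] followed by [e], so the difference is [g e]. *)
- rewrite -phi1 -phi2 -cats1 path_edges_cat big_cat/= p1e.
  rewrite /path_edges/= big_seq1 addrAC subrr add0r -surjective_pairing.
  by rewrite /g enum_valK_in.
- by exists (e.2 :: p2) => /=; rewrite /edge_rel -surjective_pairing eE e2p2.
- by exists x, p1; rewrite xin xp1 p1e eqxx.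
- by exists p2; rewrite e2p2.
- exists x, (rcons p1 e.2); rewrite xin rcons_path xp1 last_rcons p1e eqxx.
  by rewrite /edge_rel -surjective_pairing eE.
Qed.

(** Rank-nullity, with the kernel identified as the row space of [coboundary]. *)
Lemma rank_path_incidence :
  (\rank path_incidence + #|internal| = #|E|)%N.
Proof.
have -> : #|internal| = \rank (kermx path_incidence^T).
  rewrite -(eqnP coboundary_free); apply/eqP; rewrite eqn_leq.
  by rewrite !mxrankS ?coboundary_sub_ker ?ker_sub_coboundary.
by rewrite mxrank_ker mxrank_tr subnKC// rank_leq_col.
Qed.

End incidence.

(** * Diagonal rescaling of the incidence matrix into the Jacobian *)

Section jacobian.
Variables (R : realType) (V : finType) (E : {set V * V}) (Vin Vout : {set V}).

(** Omitting the weight of an edge on the path amounts to dividing the monomial by it. *)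
Lemma path_jacobian_incidence (w : 'rV[R]_#|E|) : (forall i, w 0 i != 0) ->
  path_jacobian Vin Vout w =
  diag_mx (\row_(p < #|io_paths E Vin Vout|) path_monomial (enum_val p) w) *m
  path_incidence R E Vin Vout *m diag_mx (\row_i (w 0 i)^-1).
Proof.
move=> w0; apply/matrixP => p i.
rewrite mul_mx_diag mul_diag_mx !mxE derive_prod_coord.
case: ifP => ip; last by rewrite mulr0 mul0r.
by rewrite mulr1 /path_monomial (bigD1 i ip)/= mulrC mulKf.
Qed.

Lemma rank_path_jacobian (w : 'rV[R]_#|E|) : (forall i, w 0 i != 0) ->
  \rank (path_jacobian Vin Vout w) = \rank (path_incidence R E Vin Vout).
Proof.
have diag_unit n (d : 'rV[R]_n) : (forall i, d 0 i != 0) -> diag_mx d \in unitmx.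
  by move=> d0; rewrite unitmxE det_diag unitfE; apply/prodf_neq0 => i _.
move=> w0; rewrite path_jacobian_incidence// mxrankMfree; last first.
  by rewrite row_free_unit diag_unit// => i; rewrite mxE invr_neq0.
rewrite eqmxMfull// row_full_unit diag_unit// => p; rewrite mxE.
exact/prodf_neq0.
Qed.

End jacobian.

Theorem theorem33 (R : realType) (V : finType) (E : {set V * V})
    (Vin Vout : {set V}) (netE : feedforward E Vin Vout) :
  generically (fun w : 'rV[R]_#|E| =>
    (\rank (path_jacobian Vin Vout w))%:Z = #|E|%:Z - #|internal Vin Vout|%:Z).
Proof.
(* The rank formula can fail only where some weight vanishes. *)
have := generically_neq0 R #|E|; apply: negligibleS.
apply: subsetC => t /rank_path_jacobian /= ->.
by rewrite -(congr1 Posz (rank_path_incidence R netE)) PoszD addrK.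
Qed.
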